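(* There exists $\epsilon\in(0,\tfrac12)$ such that for all sufficiently large positive integers $n$, $$u(n)\leq\frac{1}{\sqrt{n}-n^{\epsilon}}.$$
   Context: For each positive integer $n$, let $O(n)$ denote the set of real $n\times n$ orthogonal matrices, and let $\|M\|_{\max}$ denote the largest absolute value of an entry of the matrix $M$. Define $u(n):=\min_{M\in O(n)}\|M\|_{\max}$, the smallest possible entrywise infinity norm of an $n\times n$ orthogonal matrix. *)

(* Defs.v *)
From HB Require Import structures.
From mathcomp Require Import all_boot all_order all_algebra.
From mathcomp Require Import all_classical all_reals all_analysis.

Set Implicit Arguments.
Unset Strict Implicit.
Unset Printing Implicit Defensive.

Import Order.TTheory GRing.Theory Num.Theory.
Import numFieldNormedType.Exports.

Local Open Scope classical_set_scope.
Local Open Scope ring_scope.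

Definition orthogonal_mx (R : realType) (n : nat) : set 'M[R]_n :=
  [set M | M^T *m M = 1%:M].

(* The norm `|M| carried by the normed module 'M[R]_n is the largest absolute
   value of an entry (mx_normrE). The infimum below is a minimum, see uP. *)
Definition u (R : realType) (n : nat) : R :=
  inf [set `|M| | M in @orthogonal_mx R n].

Arguments orthogonal_mx : clear implicits.
Arguments u : clear implicits.

Lemma vec_mx_continuous (R : realType) (m n : nat) :
  continuous (@vec_mx R m n).
Proof.
move=> v; have Fv := nbhs_filter v; apply/cvg_ballP => e e0.
apply: filterS (nbhsx_ballx v e e0) => w [_ vw].
by split => // i j; rewrite !mxE; exact: vw.
Qed.

Lemma orthogonal_mx_entry_le1 (R : realType) (n : nat) (M : 'M[R]_n) i j :
  orthogonal_mx R n M -> `|M i j| <= 1.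
Proof.
move=> /matrixP/(_ j j); rewrite !mxE eqxx mulr1n (bigD1 i)//= !mxE -expr2 => MM.
rewrite -(@expr_le1 _ 2)// real_normK ?num_real// -MM lerDl sumr_ge0// => k _.
by rewrite !mxE -expr2 sqr_ge0.
Qed.

Lemma orthogonal_mx_compact (R : realType) (n : nat) :
  compact [set v : 'rV[R]_(n * n) | orthogonal_mx R n (vec_mx v)].
Proof.
apply: bounded_closed_compact.
  exists 1; split; first exact: num_real.
  move=> x x1 v /= Ov; rewrite (le_trans _ (ltW x1))//.
  rewrite [leLHS]/Num.Def.normr/= mx_normrE; apply: bigmax_le => // -[i j] _ /=.
  have [p q] := mxvec_indexP j; rewrite ord1.
  have := orthogonal_mx_entry_le1 p q Ov.
  by rewrite mxE.
rewrite (_ : [set v | _] = \bigcap_(ij in [set: 'I_n * 'I_n])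
    ((fun v : 'rV[R]_(n * n) =>
        \sum_k vec_mx v k ij.1 * vec_mx v k ij.2) @^-1`
      [set x | x = (ij.1 == ij.2)%:R])); last first.
  apply/seteqP; split=> v /=.
    move=> /matrixP Ov -[i j] _ /=; move: (Ov i j); rewrite !mxE => <-.
    by apply: eq_bigr => k _; rewrite [in RHS]mxE.
  move=> Ov; apply/matrixP => i j; rewrite !mxE -(Ov (i, j))//.
  by apply: eq_bigr => k _; rewrite [in LHS]mxE.
apply: closed_bigI => -[i j] _; apply: preimage_closed; last exact: closed_eq.
move=> v _.
have cont p q : continuous (fun w : 'rV[R]_(n * n) => vec_mx w p q).
  move=> w; apply: (@continuous_comp _ _ _ vec_mx (fun M : 'M[R]_n => M p q)).
    exact: vec_mx_continuous.
  exact: coord_continuous.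
apply: (@cvg_big _ _ _ _ _ add_continuous _ (nbhs v) _ _ _ (nbhs_filter v)) => k _.
by apply: continuousM; exact: cont.
Qed.

Lemma uP (R : realType) (n : nat) :
  exists2 M, orthogonal_mx R n M &
    u R n = `|M| /\ forall N, orthogonal_mx R n N -> u R n <= `|N|.
Proof.
have [||v Ov vmin] := @compact_EVT_min _ R (fun v => `|vec_mx v : 'M[R]_n|) _ _
    (@orthogonal_mx_compact R n).
- by exists (mxvec 1%:M); rewrite /= /orthogonal_mx/= mxvecK trmx1 mulmx1.
- apply: continuous_subspaceT => v.
  by apply: continuous_comp; [exact: vec_mx_continuous | exact: norm_continuous].
have uv : u R n = `|vec_mx v : 'M[R]_n|.
  apply/eqP; rewrite eq_le; apply/andP; split.
    apply: ge_inf; last by exists (vec_mx v) => //; rewrite inE in Ov.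
    by exists 0 => _ [N _ <-].
  apply: lb_le_inf.
    by exists `|vec_mx v : 'M[R]_n|, (vec_mx v) => //; rewrite inE in Ov.
  by move=> _ [N ON <-]; have := vmin (mxvec N); rewrite inE /= mxvecK; exact.
exists (vec_mx v); first by rewrite inE in Ov.
by rewrite uv; split=> // N ON; have := vmin (mxvec N); rewrite inE /= mxvecK; exact.
Qed.

(* Main.v *)
Require Import Defs.
From mathcomp Require Import all_boot all_order all_algebra.
From mathcomp Require Import all_classical all_reals all_analysis.
From mathcomp Require Import zify ring lra.

Set Implicit Arguments.
Unset Strict Implicit.
Unset Printing Implicit Defensive.

Import Order.TTheory GRing.Theory Num.Theory.
Import numFieldNormedType.Exports.

Local Open Scope classical_set_scope.
Local Open Scope ring_scope.

(** Write [e = 5/12].  It is enough to find, for large [n], an orthogonal matrix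
    of order [n] whose entries are at most [(1 + O(n^(-1/6))) / sqrt n], because
    [1 / (sqrt n - n^e)] is at least [(1 + n^(-1/12)) / sqrt n].

    Such a matrix is cut out of a slightly larger one, of order [4^(s+1) * q],
    which has entries [0, 1, -1] up to a common factor and only few zeros.  The
    larger matrix is an array [f (j - i) *m F] indexed by the cyclic group of
    order [4 * q], whose blocks [f k] of order [N = 4^s] satisfy
    [f (- k) = (f k)^T] and have a convolution square supported at [0]; the
    Hadamard matrix [F] spreads each block, without which most entries would
    vanish.

    The sequence [f] starts from [0] and grows by a doubling of the block size
    ([flat_block_seq_double]): a real sequence [x], with support disjoint from
    that of [f], is put in the off-diagonal blocks,
      [ f k     x k   ]
      [ x (-k)  - f k ]
    and the convolution square of [f] increases by the autocorrelation of [x].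
    It remains to find sequences [x] that fill almost the whole group and whose
    autocorrelations add up to a multiple of the indicator of [0].  A Golay pair
    of length [2^t] has autocorrelations of this kind, but its two members occupy
    only a stretch of length [2^(t+1)]; each of them is copied, up to sign, to
    the places [+-k] and [+-k + 2q] ([symmetrize]), which multiplies its
    autocorrelation by [4] and keeps the support symmetric, as [f (- k) = (f k)^T] requires.
    Taking in each round the largest Golay pair that fits in the remaining
    stretch leaves a proportion at most about [2^(-s)] of the group empty after
    [s] rounds ([perfect_block_seq_exists]), while the blocks have order [4^s]
    only.

    The four multiples of [q] always remain empty, so that the rows and the
    columns indexed by them meet in a zero block of order [4^(s+1)].  Inside it
    any [k <= 4^(s+1)] indices can be removed: if [block_mx 0 B C D] is
    orthogonal, so is [D + C *m B] ([orthogonal_mx_delete]), and [C *m B] has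
    entries of size at most about [k / n].  With [4^(s+1)] of order [n^(1/3)] both errors, the
    empty places and the product [C *m B], are of relative size [n^(-1/6)]. *)

(** * Autocorrelation on a finite abelian group *)

Section Autocorrelation.

Variables (R : numFieldType) (G : finZmodType).
Implicit Types (x y a b u : G -> R) (d : G).

Definition acorr x d : R := \sum_k x k * x (k - d).

Lemma acorr_shift x c d : acorr (fun k => x (k - c)) d = acorr x d.
Proof.
rewrite /acorr (reindex_inj (addIr c)) /=; apply: eq_bigr => k _.
by rewrite addrK (addrAC k) addrK.
Qed.

Lemma acorr_opp x d : acorr x (- d) = acorr x d.
Proof.
rewrite /acorr (reindex_inj (addIr (- d))) /=; apply: eq_bigr => k _.
by rewrite opprK subrK mulrC.
Qed.

Lemma acorr_rev x d : acorr (fun k => x (- k)) d = acorr x d.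
Proof.
rewrite -acorr_opp /acorr (reindex_inj oppr_inj) /=; apply: eq_bigr => k _.
by rewrite opprK opprD !opprK.
Qed.

Lemma acorr_sum_diff a b d :
  acorr (fun k => a k + b k) d + acorr (fun k => a k - b k) d =
  2 * (acorr a d + acorr b d).
Proof.
rewrite /acorr -!big_split mulr_sumr /=; apply: eq_bigr => k _; ring.
Qed.

Lemma eq_acorr x y d : x =1 y -> acorr x d = acorr y d.
Proof. by move=> xy; apply: eq_bigr => k _; rewrite !xy. Qed.

(** Translation by [p] turns [x + y] into [x - y], so these two have the same
    autocorrelation, which is the mean given by [acorr_sum_diff]. *)
Lemma acorr_periodic_antiperiodic p x y d :
    (forall k, x (k + p) = x k) -> (forall k, y (k + p) = - y k) ->
  acorr (fun k => x k + y k) d = acorr x d + acorr y d.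
Proof.
move=> xp yp.
have eq_sum_diff : acorr (fun k => x k - y k) d = acorr (fun k => x k + y k) d.
  rewrite -(acorr_shift _ (- p)); apply: eq_acorr => k.
  by rewrite opprK xp yp opprK.
have two_neq0 : (2 : R) != 0 by rewrite pnatr_eq0.
by apply: (mulfI two_neq0); rewrite -acorr_sum_diff eq_sum_diff; ring.
Qed.

(** Copies of [u], up to sign, on the images of its support under
    [k |-> - k] and the half-turn [k |-> k + p]: a [p]-periodic part plus a
    [p]-antiperiodic reflected part, which do not interact. *)
Definition symmetrize (p : G) u (k : G) : R :=
  (u k + u (k + p)) + (u (- k) - u (- k + p)).

Lemma acorr_symmetrize p u d :
  p + p = 0 -> acorr (symmetrize p u) d = 4 * acorr u d.
Proof.
move=> pp; have Np : - p = p by apply/eqP; rewrite eq_sym -addr_eq0 pp.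
rewrite (acorr_periodic_antiperiodic (p := p)); first last.
- by move=> k; rewrite opprD Np -addrA pp addr0 opprB.
- by move=> k; rewrite -addrA pp addr0 addrC.
rewrite (acorr_rev (fun k => u k - u (k + p))) acorr_sum_diff.
have -> : acorr (fun k => u (k + p)) d = acorr u d.
  rewrite -(acorr_shift u (- p)); apply: eq_acorr => k.
  by rewrite opprK.
ring.
Qed.

End Autocorrelation.

(** * Golay pairs in a cyclic group *)

Lemma val_ordD n (k l : 'I_n.+1) :
  nat_of_ord (k + l)%R =
  if (k + l < n.+1)%N then (k + l)%N else (k + l - n.+1)%N.
Proof.
rewrite /=; case: ltnP => [/modn_small //|h].
rewrite -[X in (X %% _)%N](subnK h) modnDr modn_small //.
by have := ltn_ord k; have := ltn_ord l; lia.
Qed.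

Lemma val_ordN n (k : 'I_n.+1) :
  nat_of_ord (- k)%R = if (k == 0 :> nat)%N then 0%N else (n.+1 - k)%N.
Proof.
rewrite /=; case: eqP => [->|k0]; first by rewrite subn0 modnn.
by rewrite modn_small //; have := ltn_ord k; lia.
Qed.

Lemma val_inZp n k : (k < n.+1)%N -> nat_of_ord (inZp k : 'I_n.+1) = k.
Proof. by move=> h; rewrite /= modn_small. Qed.

Lemma norm_addr_disjoint (R : numDomainType) (x y : R) :
  `|x| <= 1 -> `|y| <= 1 -> (x != 0 -> y != 0 -> False) -> `|x + y| <= 1.
Proof.
move=> x1 y1 xy; have [->|x0] := eqVneq x 0; first by rewrite add0r.
by have [->|y0] := eqVneq y 0; [rewrite addr0 | case: xy].
Qed.

Lemma addr_neq0 (V : zmodType) (x y : V) : x + y != 0 -> x != 0 \/ y != 0.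
Proof.
by have [->|] := eqVneq x 0; [rewrite add0r; right | left].
Qed.

(** Rudin-Shapiro doubling: if [s] is [b] moved past the support of [a], then
    [a + s] and [a - s] have disjointly supported terms and, by the parallelogram
    identity [acorr_sum_diff], twice the total autocorrelation. *)
Lemma golay_pair (R : numFieldType) n t : (2 ^ t <= n.+1)%N ->
  exists a b : 'I_n.+1 -> R,
    [/\ forall k, `|a k| <= 1 /\ `|b k| <= 1,
        forall k, (a k != 0 -> (k < 2 ^ t)%N) /\ (b k != 0 -> (k < 2 ^ t)%N)
      & forall d, acorr a d + acorr b d = (2 ^ t.+1 * (d == 0))%:R].
Proof.
elim: t => [|t IH] ht.
  pose e (k : 'I_n.+1) : R := (k == 0)%:R; exists e, e; split.
  - by move=> k; rewrite /e; case: (k == 0); rewrite ?normr1 ?normr0.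
  - by move=> k; rewrite /e pnatr_eq0 eqb0 negbK; split=> /eqP ->.
  move=> d; suff -> : acorr e d = (d == 0)%:R by rewrite -natrD; congr _%:R; lia.
  rewrite /acorr (bigD1 0) //= big1 => [|k /negbTE k0]; last first.
    by rewrite /e k0 mul0r.
  by rewrite /e eqxx mul1r addr0 sub0r oppr_eq0.
have ht' : (2 ^ t < n.+1)%N by move: ht; rewrite expnS; lia.
have [a [b [ab1 abs abc]]] := IH (ltnW ht').
pose c : 'I_n.+1 := inZp (2 ^ t); have cE : nat_of_ord c = (2 ^ t)%N by exact: val_inZp.
pose s k := b (k - c).
have ss k : s k != 0 -> (2 ^ t <= k < 2 ^ t.+1)%N.
  move=> /(abs _).2 h; have := val_ordD (k - c) c; rewrite subrK cE => ->.
  move: h ht; rewrite expnS; set z := nat_of_ord (k - c).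
  by move=> h1 h2; rewrite ifT; lia.
have as_ k : a k != 0 -> s k != 0 -> False.
  by move=> /(abs _).1 h /ss; rewrite leqNgt h.
exists (fun k => a k + s k), (fun k => a k - s k); split.
- move=> k; split; apply: norm_addr_disjoint; rewrite ?normrN ?oppr_eq0.
  + exact: (ab1 k).1.
  + exact: (ab1 _).2.
  + exact: as_.
  + exact: (ab1 k).1.
  + exact: (ab1 _).2.
  + exact: as_.
- have as2 k : a k != 0 \/ s k != 0 -> (k < 2 ^ t.+1)%N.
    move=> [/(abs _).1 h|/ss /andP[]//]; apply: leq_trans h _.
    by rewrite leq_exp2l.
  move=> k; split=> /addr_neq0; rewrite ?oppr_eq0; exact: as2.
move=> d; rewrite acorr_sum_diff (acorr_shift b c) abc -natrM; congr _%:R.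
by rewrite [in RHS]expnS mulnA.
Qed.

(** For [k < 4 * q], this is the distance from [k] to the nearest multiple of
    [2 * q]; it is invariant under [k |-> - k] and [k |-> k + 2 * q] in the cyclic
    group of order [4 * q], so it labels the orbits that [symmetrize] fills. *)
Definition half_turn_dist q k := minn k (minn ((k - 2 * q) + (2 * q - k)) (4 * q - k)).

Lemma half_turn_dist_opp n q (k : 'I_n.+1) :
  n.+1 = (4 * q)%N -> half_turn_dist q (- k)%R = half_turn_dist q k.
Proof.
move=> nq; have := ltn_ord k; rewrite val_ordN; case: eqP => [->|k0]; rewrite /half_turn_dist; lia.
Qed.

(** A stretch within ]0, q[ has disjoint images in the four quarters of the cyclic
    group of order [4 * q]. *)
Lemma symmetrize_support (R : numFieldType) n q lo hi (p : 'I_n.+1)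
    (u : 'I_n.+1 -> R) :
    n.+1 = (4 * q)%N -> p = (2 * q)%N :> nat -> (0 < lo)%N -> (hi < q)%N -> (forall k, `|u k| <= 1) ->
    (forall k, u k != 0 -> (lo <= k <= hi)%N) ->
  forall k, `|symmetrize p u k| <= 1 /\
    (symmetrize p u k != 0 -> (lo <= half_turn_dist q k <= hi)%N).
Proof.
move=> nq pE lo0 hiq u1 us k.
have kn := ltn_ord k; have s1 := us k.
have s2 : u (k + p) != 0 -> (2 * q + lo <= k <= 2 * q + hi)%N.
  by move=> /us; rewrite val_ordD pE; case: ltnP; lia.
have s3 : u (- k) != 0 -> (4 * q - hi <= k <= 4 * q - lo)%N.
  by move=> /us; rewrite val_ordN; case: eqP; lia.
have s4 : u (- k + p) != 0 -> (2 * q - hi <= k <= 2 * q - lo)%N.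
  by move=> /us; rewrite val_ordD val_ordN pE; case: eqP => k0; case: ltnP; lia.
have n4 z : (- u z != 0) = (u z != 0) by rewrite oppr_eq0.
rewrite /symmetrize; split; last first.
  case/addr_neq0=> /addr_neq0[]; rewrite ?n4.
  - by move/s1; rewrite /half_turn_dist; lia.
  - by move/s2; rewrite /half_turn_dist; lia.
  - by move/s3; rewrite /half_turn_dist; lia.
  - by move/s4; rewrite /half_turn_dist; lia.
have uN1 z : `|- u z| <= 1 by rewrite normrN.
apply: norm_addr_disjoint.
- by apply: norm_addr_disjoint => // /s1 h1 /s2 h2; lia.
- apply: norm_addr_disjoint => //.
  by rewrite n4 => /s3 h1 /s4 h2; lia.
move=> /addr_neq0 + /addr_neq0; rewrite n4.
by move=> [/s1|/s2] h1 [/s3|/s4] h2; lia.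
Qed.

(** * Sequences of blocks *)

Section BlockSequences.

Variables (R : numFieldType) (n q : nat).
Hypothesis nq : n.+1 = (4 * q)%N.

(** The matrix [F] is a Hadamard matrix.  It is kept apart from [f] because the
    symmetry of [f] would be lost in the products [f k *m F].  The bound [L] on
    the support measures how much of the group has been filled. *)
Definition flat_block_seq (N L : nat) (c : 'I_n.+1 -> R) :=
  exists (f : 'I_n.+1 -> 'M[R]_N) (F : 'M[R]_N),
  [/\ forall k, f (- k) = (f k)^T,
      forall d, \sum_k f k *m f (d - k) = (c d)%:M,
      F *m F^T = N%:R%:M,
      forall k, f k != 0 -> (0 < half_turn_dist q k <= L)%N
    & (forall k i j, `|(f k *m F) i j| <= 1) /\ (forall i j, `|F i j| <= 1)].

Lemma flat_block_seq_nil : flat_block_seq 1 0 (fun=> 0).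
Proof.
exists (fun=> 0), 1%:M; split.
- by move=> k; rewrite trmx0.
- by move=> d; rewrite big1 ?scale_scalar_mx ?raddf0 // => k _; rewrite mul0mx.
- by rewrite trmx1 mulmx1.
- by move=> k; rewrite eqxx.
split=> [k i j|i j]; rewrite ?mul0mx !mxE ?normr0 //.
by case: (i == j); rewrite ?normr1 ?normr0.
Qed.

Lemma block_mx_entry_le (N : nat) (A B C D : 'M[R]_N) :
    (forall i j, `|A i j| <= 1) -> (forall i j, `|B i j| <= 1) ->
    (forall i j, `|C i j| <= 1) -> (forall i j, `|D i j| <= 1) ->
  forall i j, `|block_mx A B C D i j| <= 1.
Proof.
move=> hA hB hC hD i j.
case: (split_ordP i) => i' ->; case: (split_ordP j) => j' ->.
- by rewrite block_mxEul.
- by rewrite block_mxEur.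
- by rewrite block_mxEdl.
- by rewrite block_mxEdr.
Qed.

Lemma sum_block_mx (I : Type) (s : seq I) (N : nat) (A B C D : I -> 'M[R]_N) :
  \sum_(k <- s) block_mx (A k) (B k) (C k) (D k) =
  block_mx (\sum_(k <- s) A k) (\sum_(k <- s) B k)
           (\sum_(k <- s) C k) (\sum_(k <- s) D k).
Proof.
elim: s => [|k s IH]; first by rewrite !big_nil block_mx0.
by rewrite !big_cons IH add_block_mx.
Qed.

(** The off-diagonal blocks of the convolution square vanish since scalar blocks
    commute with [f]: they are differences of a convolution and its reversal.
    Flatness persists because each block of [f' k *m F'] is, up to sign,
    [f k *m F] plus or minus a multiple of [F], and at most one of the two terms
    is non-zero by disjointness of supports. *)
Lemma flat_block_seq_double N L L' c (x : 'I_n.+1 -> R) :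
    (L <= L')%N -> (forall k, `|x k| <= 1) ->
    (forall k, x k != 0 -> (L < half_turn_dist q k <= L')%N) ->
  flat_block_seq N L c -> flat_block_seq (N + N) L' (fun d => c d + acorr x d).
Proof.
move=> LL' x1 xs [f [F [fT fc FF fs [fF1 F1]]]].
have xNs k : x (- k) != 0 -> (L < half_turn_dist q k <= L')%N.
  by move=> /xs; rewrite half_turn_dist_opp.
pose f' k : 'M[R]_(N + N) := block_mx (f k) (x k)%:M (x (- k))%:M (- f k).
pose F' : 'M[R]_(N + N) := block_mx F F F (- F).
exists f', F'; split.
- by move=> k; rewrite /f' tr_block_mx !tr_scalar_mx fT opprK raddfN.
- move=> d.
  have -> : \sum_k f' k *m f' (d - k) =
      block_mx (\sum_k (f k *m f (d - k) + (x k * x (k - d))%:M))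
        (\sum_k (x (d - k) *: f k - x k *: f (d - k)))
        (\sum_k (x (- k) *: f (d - k) - x (k - d) *: f k))
        (\sum_k ((x (- k) * x (d - k))%:M + f k *m f (d - k))).
    rewrite -sum_block_mx; apply: eq_bigr => k _.
    rewrite /f' mulmx_block; congr block_mx.
    + by rewrite opprB -scalar_mxM.
    + by rewrite mul_mx_scalar mul_scalar_mx scalerN.
    + by rewrite opprB mul_scalar_mx mulNmx mul_mx_scalar.
    + by rewrite -scalar_mxM mulNmx mulmxN opprK.
  rewrite [RHS]scalar_mx_block; congr block_mx.
  + by rewrite big_split /= fc -raddf_sum /= -raddfD.
  + rewrite big_split /= sumrN; apply/eqP; rewrite subr_eq0; apply/eqP.
    rewrite (reindex_inj (subrI d)) /=; apply: eq_bigr => k _.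
    by rewrite subKr.
  + rewrite big_split /= sumrN; apply/eqP; rewrite subr_eq0; apply/eqP.
    rewrite (reindex_inj (subrI d)) /=; apply: eq_bigr => k _.
    by rewrite subKr opprB.
  rewrite big_split /= fc -raddf_sum /= addrC -raddfD; congr (_ + _)%:M.
  by rewrite -acorr_rev; apply: eq_bigr => k _; rewrite opprB.
- rewrite /F' tr_block_mx mulmx_block raddfN /= !mulmxN !mulNmx opprK FF subrr.
  by rewrite -raddfD /= -natrD [RHS]scalar_mx_block.
- move=> k; rewrite /f' -block_mx0.
  have [-> |f0 _] := eqVneq (f k) 0; last by have := fs k f0; lia.
  have [-> |x0 _] := eqVneq (x k) 0; last by have := xs k x0; lia.
  have [-> |x0 _] := eqVneq (x (- k)) 0; last by have := xNs k x0; lia.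
  by rewrite !raddf0 ?oppr0 eqxx.
split=> [k|]; last first.
  apply: block_mx_entry_le => // i j; by rewrite mxE normrN.
have le1 y : `|y| <= 1 -> (y != 0 -> (L < half_turn_dist q k)%N) ->
    forall i j, `|(f k *m F + y *: F) i j| <= 1.
  move=> y1 ys i j; have [y0|y0] := eqVneq y 0.
    by rewrite y0 scale0r addr0.
  have [f0|/fs] := eqVneq (f k) 0; last by have := ys y0; lia.
  rewrite f0 mul0mx add0r mxE normrM -(mulr1 1); exact: ler_pM.
have le1' y : `|y| <= 1 -> (y != 0 -> (L < half_turn_dist q k)%N) ->
    forall i j, `|(y *: F - f k *m F) i j| <= 1.
  move=> y1 ys i j; have := le1 (- y); rewrite normrN oppr_eq0 => h.
  by rewrite -normrN !mxE opprB; have := h y1 ys i j; rewrite !mxE mulNr.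
have xk : x k != 0 -> (L < half_turn_dist q k)%N by move=> /xs /andP[].
have xNk : x (- k) != 0 -> (L < half_turn_dist q k)%N by move=> /xNs /andP[].
rewrite /f' /F' mulmx_block !mul_scalar_mx !mulmxN !mulNmx opprK scalerN.
apply: block_mx_entry_le.
- exact: le1.
- move=> i j; rewrite -normrN; have := le1' (x k) (x1 k) xk i j.
  by rewrite !mxE opprB.
- exact: le1'.
- by rewrite addrC; exact: le1.
Qed.

End BlockSequences.

(** * Filling the cyclic group *)

Section Filling.

Variables (R : numFieldType) (n q : nat).
Hypothesis nq : n.+1 = (4 * q)%N.

(** Four places lie at each of the distances from [1] to [L]; when all of them
    hold signed permutation matrices, the convolution square is [4 * L] at [0]. *)
Definition perfect_block_seq (N L : nat) :=
  flat_block_seq q N L (fun d : 'I_n.+1 => (4 * L * (d == 0))%:R : R).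

(** The two members of a Golay pair fill two consecutive stretches of length
    [2 ^ t], at the price of two doublings. *)
Lemma perfect_block_seq_golay N L t : (L + 2 ^ t.+1 < q)%N ->
  perfect_block_seq N L -> perfect_block_seq (4 * N) (L + 2 ^ t.+1).
Proof.
move=> Ltq fL; have tn : (2 ^ t <= n.+1)%N by move: Ltq; rewrite nq expnS; lia.
have [a [b [ab1 abs abc]]] := golay_pair R tn.
have [p pE] : exists p : 'I_n.+1, p = (2 * q)%N :> nat.
  by exists (inZp (2 * q)); apply: val_inZp; lia.
have pp : p + p = 0.
  by apply/val_inj; rewrite /= pE nq -mulnDl modnn.
pose shift m (u : 'I_n.+1 -> R) k := u (k - inZp m).
have supp m (u : 'I_n.+1 -> R) : (m + 2 ^ t < q)%N -> (forall k, `|u k| <= 1) ->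
    (forall k, u k != 0 -> (k < 2 ^ t)%N) ->
  forall k, `|symmetrize p (shift m.+1 u) k| <= 1 /\
    (symmetrize p (shift m.+1 u) k != 0 -> (m < half_turn_dist q k <= m + 2 ^ t)%N).
  move=> mq u1 us.
  apply: symmetrize_support => // k; first exact: u1.
  move=> /us; set l := k - inZp m.+1 => lt_t.
  have -> : k = l + inZp m.+1 by rewrite subrK.
  by rewrite val_ordD val_inZp; [case: (ltnP (_ + _) n.+1); lia | lia].
pose L1 := (L + 2 ^ t)%N.
have L1E : (L1 + 2 ^ t = L + 2 ^ t.+1)%N by rewrite expnS /L1; lia.
have L1q : (L1 < q)%N by lia.
have xa := supp L a L1q (fun k => (ab1 k).1) (fun k => (abs k).1).
have L1tq : (L1 + 2 ^ t < q)%N by rewrite L1E.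
have xb := supp L1 b L1tq (fun k => (ab1 k).2) (fun k => (abs k).2).
rewrite L1E in xb.
have L1t : (L1 <= L + 2 ^ t.+1)%N by lia.
have := flat_block_seq_double nq L1t (fun k => (xb k).1) (fun k => (xb k).2)
  (flat_block_seq_double nq (leq_addr _ _) (fun k => (xa k).1)
    (fun k => (xa k).2) fL).
rewrite /perfect_block_seq.
have -> : (N + N + (N + N) = 4 * N)%N by lia.
congr flat_block_seq; apply: funext => d.
rewrite !acorr_symmetrize // /shift !acorr_shift -addrA -mulrDr abc -natrM -natrD.
congr _%:R; case: (d == 0); rewrite expnS; lia.
Qed.

(** Doubling with the zero sequence: it brings the blocks to the order [4 ^ s]
    when no further Golay pair fits. *)
Lemma perfect_block_seq_pad N L :
  perfect_block_seq N L -> perfect_block_seq (4 * N) L.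
Proof.
have x1 (k : 'I_n.+1) : `|0 : R| <= 1 by rewrite normr0.
have xs (k : 'I_n.+1) : (0 : R) != 0 -> (L < half_turn_dist q k <= L)%N by rewrite eqxx.
move=> /(flat_block_seq_double nq (leqnn L) x1 xs).
move=> /(flat_block_seq_double nq (leqnn L) x1 xs).
rewrite /perfect_block_seq; have -> : (N + N + (N + N) = 4 * N)%N by lia.
congr flat_block_seq; apply: funext => d.
by rewrite /acorr big1 ?addr0 // => k _; rewrite mul0r.
Qed.

(** Greedy filling: the largest power of two that fits in the remaining stretch is
    more than half of it, so each round halves the remainder; a remainder [1] is
    not filled, whence the summand [2 ^ s]. *)
Lemma perfect_block_seq_exists s : exists L,
  [/\ (L < q)%N, (2 ^ s * (q.-1 - L) <= q.-1 + 2 ^ s)%N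
    & perfect_block_seq (4 ^ s) L].
Proof.
elim: s => [|s [L [Lq Ls fL]]].
  exists 0%N; split; [lia | lia |].
  rewrite /perfect_block_seq expn0; have := flat_block_seq_nil R n q.
  congr flat_block_seq; exact: funext.
(* A Golay pair occupies at least two places, so a remainder 1 stays. *)
have [r1|r1] := leqP (q.-1 - L) 1.
  exists L; split=> //; last by rewrite expnS; exact: perfect_block_seq_pad.
  by rewrite (leq_trans _ (leq_addl _ _)) // -[leqRHS]muln1 leq_mul2l r1 orbT.
set r := (q.-1 - L)%N in Ls r1.
have /andP[h1 h2] := trunc_log_bounds (p := 2) isT (ltnW r1).
have t0 : (0 < trunc_log 2 r)%N by rewrite trunc_log_gt0; lia.
move: h1 h2; rewrite -(prednK t0); set t := (trunc_log 2 r).-1 => h1 h2.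
have Lt : (L + 2 ^ t.+1 < q)%N by move: r1 h1; rewrite /r; lia.
exists (L + 2 ^ t.+1)%N; split=> //.
  have : (2 * (q.-1 - (L + 2 ^ t.+1)) <= r)%N by move: h2; rewrite [in X in X -> _]expnS /r; lia.
  rewrite -(leq_pmul2l (m := 2 ^ s)) ?expn_gt0 // mulnA -expnSr => h.
  by rewrite (leq_trans h) // (leq_trans Ls) // leq_add2l leq_exp2l.
by rewrite expnS; exact: perfect_block_seq_golay.
Qed.

End Filling.

(** * Orthogonal matrices *)

Lemma flat_array_exists (R : numFieldType) n q N L :
    n.+1 = (4 * q)%N -> perfect_block_seq R n q N L ->
  exists U : 'I_n.+1 * 'I_N -> 'I_n.+1 * 'I_N -> R,
  [/\ forall a b, \sum_c U a c * U b c = (4 * N * L)%:R * (a == b)%:R,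
      forall a b, `|U a b| <= 1
    & forall a b : 'I_n.+1 * 'I_N, ~~ (0 < half_turn_dist q (b.1 - a.1)%R <= L)%N -> U a b = 0].
Proof.
move=> nq [f [F [fT fc FF fs [fF1 _]]]].
exists (fun a b => (f (b.1 - a.1) *m F) a.2 b.2); split=> //; last first.
  move=> a b; have [->|/fs ->//] := eqVneq (f (b.1 - a.1)) 0.
  by rewrite mul0mx mxE.
move=> [i r] [j s] /=.
rewrite -(pair_bigA _ (fun k c => (f (k - i) *m F) r c * (f (k - j) *m F) s c)) /=.
have -> : \sum_k \sum_c (f (k - i) *m F) r c * (f (k - j) *m F) s c =
    (N%:R *: \sum_k f k *m f (j - i - k)) r s.
  rewrite scaler_sumr summxE (reindex_inj (addIr i)) /=; apply: eq_bigr => k _.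
  have -> : k + i - j = - (j - i - k) by rewrite !opprB addrA.
  rewrite addrK fT; set g := f (j - i - k).
  transitivity (((f k *m F) *m (g^T *m F)^T) r s).
    by rewrite [RHS]mxE; apply: eq_bigr => c _; congr (_ * _); rewrite [RHS]mxE.
  by rewrite trmx_mul trmxK mulmxA -(mulmxA (f k)) FF mul_mx_scalar scalemxAl.
rewrite fc scale_scalar_mx !mxE subr_eq0 xpair_eqE (eq_sym j) -natrM.
by case: (i == j); case: (r == s); rewrite ?(mulr1n, mulr0n, mulr1, mulr0, muln1, muln0) //; congr _%:R; lia.
Qed.

(** Write the normalized array as [block_mx 0 B C D], with [K] first.  Its rows are
    orthonormal: [B *m B^T = 1], [B *m D^T = 0] and [C *m C^T + D *m D^T = 1],
    which give [(D + C *m B) *m (D + C *m B)^T = 1].  Each entry of [C *m B] is a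
    sum of [#|K|] terms of size at most [1 / mu]. *)
Lemma orthogonal_mx_delete (R : rcfType) (J : finType) (K : {set J})
    (U : J -> J -> R) (mu : R) : 0 < mu ->
    (forall a b, \sum_c U a c * U b c = mu * (a == b)%:R) ->
    (forall a b, `|U a b| <= 1) ->
    (forall a b, a \in K -> b \in K -> U a b = 0) ->
  exists2 M : 'M[R]_#|~: K|, M^T *m M = 1%:M &
    forall i j, `|M i j| <= (Num.sqrt mu)^-1 + #|K|%:R / mu.
Proof.
move=> mu0 UU U1 UK; pose nu := (Num.sqrt mu)^-1.
have nu0 : 0 <= nu by rewrite invr_ge0 sqrtr_ge0.
have nu2 : nu ^+ 2 = mu^-1 by rewrite exprVn sqr_sqrtr // ltW.
pose sub (A A' : {set J}) : 'M[R]_(#|A|, #|A'|) :=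
  \matrix_(i, j) (nu * U (enum_val i) (enum_val j)).
pose B := sub K (~: K); pose C := sub (~: K) K; pose D := sub (~: K) (~: K).
have gram A A' : sub A K *m (sub A' K)^T + sub A (~: K) *m (sub A' (~: K))^T =
    \matrix_(i, j) (enum_val i == enum_val j)%:R.
  apply/matrixP => i j; rewrite !mxE.
  have E X : \sum_k sub A X i k * (sub A' X)^T k j =
      nu ^+ 2 * \sum_(c in X) U (enum_val i) c * U (enum_val j) c.
    rewrite mulr_sumr [RHS]big_enum_val; apply: eq_bigr => k _; rewrite !mxE; ring.
  rewrite !E -mulrDr.
  rewrite [X in _ + X](eq_bigl (fun c => c \notin K)) => [|c]; last by rewrite inE.
  have := UU (enum_val i) (enum_val j); rewrite (bigID (mem K)) /=.
  by move=> ->; rewrite nu2 mulKf // gt_eqF.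
have one A : \matrix_(i < #|A|, j < #|A|) (enum_val i == enum_val j)%:R = 1%:M :> 'M[R]_#|A|.
  by apply/matrixP => i j; rewrite !mxE (inj_eq enum_val_inj) mulrb; case: eqP.
have KK : sub K K = 0.
  by apply/matrixP => i j; rewrite !mxE UK ?mulr0 // enum_valP.
have BB : B *m B^T = 1%:M by rewrite -one -gram KK mul0mx add0r.
have BD : B *m D^T = 0.
  have := gram K (~: K); rewrite KK mul0mx add0r => ->.
  apply/matrixP => i j; rewrite !mxE; case: eqP => [ij|//].
  have := enum_valP j.
  by rewrite -ij inE enum_valP.
have CD : C *m C^T + D *m D^T = 1%:M by rewrite -one -gram.
have DB : D *m B^T = 0 by rewrite -[LHS]trmxK trmx_mul trmxK BD trmx0.
exists (D + C *m B).
  apply: mulmx1C; rewrite raddfD /= trmx_mul mulmxDl !mulmxDr.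
  rewrite !mulmxA DB mul0mx addr0 -(mulmxA C B) BD mulmx0 add0r.
  by rewrite -(mulmxA C B) BB mulmx1 addrC.
move=> i j; rewrite mxE (le_trans (ler_normD _ _)) // lerD //.
  by rewrite mxE normrM ger0_norm // ler_piMr.
rewrite mxE (le_trans (ler_norm_sum _ _ _)) //.
have -> : #|K|%:R / mu = \sum_(k < #|K|) nu ^+ 2.
  by rewrite sumr_const card_ord nu2 mulr_natl.
apply: ler_sum => k _; rewrite !mxE !normrM ger0_norm // mulrACA -expr2.
by rewrite ler_piMr ?exprn_ge0 // mulr_ile1.
Qed.

Lemma subset_of_card (T : finType) (A : {set T}) k : (k <= #|A|)%N ->
  exists2 B : {set T}, B \subset A & #|B| = k.
Proof.
rewrite cardE => kA; exists [set x in take k (enum A)].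
  by apply/fintype.subsetP => x; rewrite inE => /mem_take; rewrite mem_enum.
by rewrite cardsE (card_uniqP _) ?take_uniq ?enum_uniq // size_takel.
Qed.

Lemma half_turn_dist_multiples n q (i j : 'I_4) : n.+1 = (4 * q)%N -> (0 < q)%N ->
  half_turn_dist q (inZp (q * j)%N - inZp (q * i)%N : 'I_n.+1)%R \in [:: 0%N; q].
Proof.
move=> nq q0; have qi (l : 'I_4) : (q * l < n.+1)%N.
  by rewrite nq mulnC ltn_pmul2r.
rewrite val_ordD val_ordN !val_inZp ?qi // !inE /half_turn_dist nq.
case: i j => [i i4] [j j4] /=; case: (eqVneq (q * i)%N 0%N) => qi0.
all: case: (ltnP _ (4 * q)); move: i i4 j j4 qi0.
all: by move=> [|[|[|[|i]]]] // _ [|[|[|[|j]]]] // _; lia.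
Qed.

(** The zero block sits at the positions [0, q, 2q, 3q]: differences of multiples
    of [q] have distance [0] or [q] to the multiples of [2q], and these distances
    are never filled. *)
Lemma near_flat_orthogonal_mx (R : rcfType) q s k : (0 < q)%N ->
    (k <= 4 ^ s.+1)%N ->
  exists2 L, (L < q /\ 2 ^ s * (q.-1 - L) <= q.-1 + 2 ^ s)%N &
    ((0 < L)%N -> exists2 M : 'M[R]_(4 ^ s.+1 * q - k), M^T *m M = 1%:M &
      forall i j, `|M i j| <= (Num.sqrt (4 ^ s.+1 * L)%:R)^-1
                             + k%:R / (4 ^ s.+1 * L)%:R).
Proof.
move=> q0 ks; set n := (4 * q).-1; have nq : n.+1 = (4 * q)%N by rewrite /n; lia.
have [L [Lq Ls fL]] := perfect_block_seq_exists R nq s.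
exists L => // L0; have [U [UU U1 U0]] := flat_array_exists nq fL.
pose J : finType := ('I_n.+1 * 'I_(4 ^ s))%type.
pose e (a : 'I_4 * 'I_(4 ^ s)) : J := (inZp (q * a.1), a.2).
have qi (i : 'I_4) : (q * i < n.+1)%N by rewrite nq mulnC ltn_pmul2r.
have e_inj : injective e.
  move=> [i r] [j t] [] + ->; rewrite !modn_small ?qi // => /eqP.
  by rewrite eqn_pmul2l // => /eqP /val_inj ->.
pose E := e @: [set: 'I_4 * 'I_(4 ^ s)]%SET.
have cardE : #|E| = (4 ^ s.+1)%N.
  by rewrite card_imset // cardsT card_prod !card_ord expnS.
have [K Ke Kk] : exists2 K : {set J}, K \subset E & #|K| = k.
  by apply: subset_of_card; rewrite cardE.
have KU a b : a \in K -> b \in K -> U a b = 0.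
  move=> /(fintype.subsetP Ke) /imsetP[[i r] _ ->] /(fintype.subsetP Ke) /imsetP[[j t] _ ->].
  apply: U0; have := half_turn_dist_multiples i j nq q0; rewrite !inE.
  by case/orP=> /eqP dE; rewrite [half_turn_dist _ _]dE //; lia.
have : #|~: K| = (4 ^ s.+1 * q - k)%N.
  by rewrite cardsCs finset.setCK card_prod !card_ord Kk nq expnS; lia.
move=> <-; rewrite -Kk.
apply: orthogonal_mx_delete KU => //.
  by rewrite ltr0n muln_gt0 expn_gt0.
by move=> a b; rewrite UU expnS.
Qed.

(** * Choice of the parameters *)

Lemma u_le_entries (R : realType) n (M : 'M[R]_n) (e : R) : 0 <= e ->
  M^T *m M = 1%:M -> (forall i j, `|M i j| <= e) -> u R n <= e.
Proof.
move=> e0 MM Me; have [N _ [_ uN]] := uP R n; apply: le_trans (uN M MM) _.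
rewrite [leLHS]/Num.Def.normr /= mx_normrE; by apply: bigmax_le => // ij _; exact: Me.
Qed.

Lemma sqr_ge_100 (R : realFieldType) (y : R) : 10 <= y -> 100 <= y ^+ 2.
Proof. by move=> y10; rewrite expr2; nra. Qed.

Lemma sqrt_density_gt0 (R : realFieldType) (y : R) :
  10 <= y -> 0 < y ^+ 6 - 5 * y ^+ 4.
Proof.
move=> y10; have y2 := sqr_ge_100 y10.
rewrite (_ : _ - _ = y ^+ 4 * (y ^+ 2 - 5)); last by ring.
by rewrite mulr_gt0 ?exprn_gt0 //; lra.
Qed.

(** Here [y] is the twelfth root of the target order, [B ^+ 2 * (h + 1)] the order
    of the large matrix and [B ^+ 2 * L] the squared norm of its rows before
    normalization.  The deficit [h - L] is at most about [2 * h / B], and [B] lies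
    between [y ^+ 2 / 2] and [y ^+ 2]. *)
Lemma density_bound (R : realFieldType) (y B h L : R) :
    10 <= y -> 0 < B -> 0 <= h -> B ^+ 6 <= y ^+ 12 -> y ^+ 12 <= 64 * B ^+ 6 ->
    B ^+ 2 * h <= y ^+ 12 -> y ^+ 12 <= B ^+ 2 * (h + 1) ->
    B * (h - L) <= 2 * h + B ->
  B ^+ 2 <= y ^+ 4 /\ (y ^+ 6 - 5 * y ^+ 4) ^+ 2 <= B ^+ 2 * L.
Proof.
move=> y10 B0 h0 By yB Qh yQ hL.
have y0 : 0 < y by lra.
have By2 : B <= y ^+ 2.
  rewrite -(@ler_pXn2r _ 6) ?nnegrE ?exprn_ge0 ?(ltW B0) ?(ltW y0) // -exprM.
  exact: By.
have yB2 : y ^+ 2 <= 2 * B.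
  rewrite -(@ler_pXn2r _ 6) ?nnegrE ?exprn_ge0 ?mulr_ge0 ?(ltW B0) ?(ltW y0) //.
  by rewrite -exprM (_ : (2 * B) ^+ 6 = 64 * B ^+ 6) //; ring.
have Q4 : B ^+ 2 <= y ^+ 4.
  rewrite (exprM y 2 2); apply: lerXn2r => //; rewrite nnegrE ?exprn_ge0 //; exact: ltW.
split=> //.
have loss : B ^+ 2 * (h - L) <= 4 * y ^+ 10 + y ^+ 4.
  have h1 : B ^+ 2 * (h - L) <= 2 * (B * h) + B ^+ 2.
    by have := ler_wpM2l (ltW B0) hL; lra.
  have h2 : B * h * y ^+ 2 <= 2 * y ^+ 12.
    have := ler_wpM2l (mulr_ge0 (ltW B0) h0) yB2; lra.
  have h3 : B * h <= 2 * y ^+ 10.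
    rewrite -(ler_pM2r (exprn_gt0 2 y0)); apply: le_trans h2 _.
    by rewrite -mulrA -exprD.
  lra.
have h4 : y ^+ 12 - 4 * y ^+ 10 - 2 * y ^+ 4 <= B ^+ 2 * L by lra.
apply: le_trans h4; have y2 := sqr_ge_100 y10.
have y8 : 100 * y ^+ 8 <= y ^+ 10.
  by rewrite (exprD y 2 8) ler_wpM2r // exprn_ge0 // ltW.
have y4 : 0 <= y ^+ 4 by rewrite exprn_ge0 ?ltW.
have y48 : y ^+ 4 <= y ^+ 8 by rewrite ler_eXn2l //; lra.
rewrite (_ : _ ^+ 2 = y ^+ 12 - 10 * y ^+ 10 + 25 * y ^+ 8); last by ring.
lra.
Qed.

(** With [mu] close to [y ^+ 12], the left side is
    [y ^- 6 * (1 + O(y ^- 2))], whereas the right side exceeds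
    [y ^- 6 * (1 + y ^- 1)]. *)
Lemma entry_bound (R : rcfType) (y mu Q : R) :
    10 <= y -> Q <= y ^+ 4 -> (y ^+ 6 - 5 * y ^+ 4) ^+ 2 <= mu -> 
  (Num.sqrt mu)^-1 + Q / mu <= 1 / (y ^+ 6 - y ^+ 5).
Proof.
move=> y10 Qy; set x := _ - _ => xmu.
have y0 : 0 < y by lra.
have y2 := sqr_ge_100 y10.
have y4 : 0 < y ^+ 4 by rewrite exprn_gt0.
have x0 : 0 < x by exact: sqrt_density_gt0.
have d0 : 0 < y ^+ 6 - y ^+ 5.
  by rewrite (_ : _ - _ = y ^+ 5 * (y - 1)); [rewrite mulr_gt0 ?exprn_gt0 //; lra | ring].
have mu0 : 0 < mu by rewrite (lt_le_trans _ xmu) // exprn_gt0.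
have h1 : (Num.sqrt mu)^-1 <= x^-1.
  rewrite lef_pV2 ?posrE ?sqrtr_gt0 //.
  by rewrite -(ger0_norm (ltW x0)) -sqrtr_sqr ler_wsqrtr.
have h2 : Q / mu <= y ^+ 4 / x ^+ 2.
  apply: (@le_trans _ _ (y ^+ 4 / mu)).
    by rewrite ler_wpM2r // invr_ge0 ltW.
  by rewrite ler_wpM2l ?(ltW y4) // lef_pV2 ?posrE ?exprn_gt0.
apply: le_trans (lerD h1 h2) _.
have -> : x^-1 + y ^+ 4 / x ^+ 2 = (x + y ^+ 4) / x ^+ 2.
  by field; rewrite gt_eqF.
rewrite ler_pdivrMr ?exprn_gt0 // mulrC mulrA mulr1 ler_pdivlMr //.
rewrite /x -subr_ge0.
have -> : (y ^+ 6 - 5 * y ^+ 4) ^+ 2 -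
    (y ^+ 6 - 5 * y ^+ 4 + y ^+ 4) * (y ^+ 6 - y ^+ 5) =
    y ^+ 8 * (y ^+ 2 * (y - 6) + (25 - 4 * y)) by ring.
rewrite mulr_ge0 ?exprn_ge0 ?(ltW y0) //.
have : 100 * (y - 6) <= y ^+ 2 * (y - 6) by rewrite ler_wpM2r //; lra.
lra.
Qed.

Theorem theorem2 (R : realType) :
  exists eps : R, 0 < eps < 2^-1 /\
    \forall n \near \oo,
      u R n <= 1 / (Num.sqrt n%:R - n%:R `^ eps).
Proof.
exists (5 / 12); split; first by apply/andP; split; lra.
have large := nbhs_infty_ger (10 ^+ 12 : R); near=> n.
have n_large : (10 ^+ 12 : R) <= n%:R by near: n.
pose y : R := n%:R `^ (12^-1).
have n0 : 0 <= n%:R :> R by [].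
have yX m : y ^+ m = n%:R `^ (m%:R / 12).
  by rewrite -powR_mulrn ?powR_ge0 // -powRrM mulrC.
have y12 : y ^+ 12 = n%:R by rewrite yX divff ?pnatr_eq0 // powRr1.
have y10 : 10 <= y.
  by rewrite -(@ler_pXn2r _ 12) ?nnegrE ?powR_ge0 // y12.
have -> : Num.sqrt n%:R = y ^+ 6 :> R.
  rewrite -y12 (exprM y 6 2) sqrtr_sqr ger0_norm // exprn_ge0 //; lra.
rewrite -(yX 5%N).
(* This makes [4 ^ c] of the order of the cube root of [n]. *)
pose c := trunc_log 64 n; pose q := (n %/ 4 ^ c).+1.
have n_gt0 : (0 < n)%N.
  by rewrite -(ltr0n R) (lt_le_trans _ n_large) // exprn_gt0.
have /andP[cn nc] := trunc_log_bounds (p := 64) isT n_gt0.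
pose B : R := 2 ^+ c.
have B4 : (4 ^ c)%:R = B ^+ 2 :> R by rewrite /B -natrX -natrX -expnM mulnC expnM.
have B6 : (64 ^ c)%:R = B ^+ 6 :> R by rewrite /B -natrX -natrX -expnM mulnC expnM.
have B0 : 0 < B by rewrite exprn_gt0.
have By : B ^+ 6 <= y ^+ 12 by rewrite y12 -B6 ler_nat.
have yB : y ^+ 12 <= 64 * B ^+ 6.
  by rewrite y12 -B6 -natrM -expnS ler_nat ltnW.
have [s cE] : exists s, c = s.+1.
  case cE : c => [|s]; last by exists s.
  by move: yB; rewrite /B cE expr0 expr1n y12; move: n_large; lra.
pose k := (4 ^ c * q - n)%N.
have n_div : (4 ^ c * (n %/ 4 ^ c) <= n < 4 ^ c * q)%N.
  rewrite mulnC leq_divM /q mulnC; apply: ltn_ceil.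
  by rewrite expn_gt0.
have kc : (k <= 4 ^ s.+1)%N by rewrite -cE /k /q; move: n_div; rewrite /q mulnS; lia.
have [L [Lq Ls] M_ex] := near_flat_orthogonal_mx R (ltn0Sn (n %/ 4 ^ c)) kc.
have hL : B * ((n %/ 4 ^ c)%:R - L%:R) <= 2 * (n %/ 4 ^ c)%:R + B.
  have -> : B = 2 * 2 ^+ s by rewrite /B cE exprS.
  rewrite -natrB; last by rewrite -ltnS.
  by rewrite -mulrA -mulrDr ler_pM2l // -natrX -natrM -natrD ler_nat.
have [Qy mu_ge] : B ^+ 2 <= y ^+ 4 /\ (y ^+ 6 - 5 * y ^+ 4) ^+ 2 <= B ^+ 2 * L%:R.
  apply: (density_bound y10 B0 _ By yB _ _ hL) => //.
    by rewrite y12 -B4 -natrM ler_nat; case/andP: n_div.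
  by rewrite y12 -B4 natr1 -natrM ler_nat ltnW; case/andP: n_div.
have := entry_bound y10 Qy mu_ge; rewrite -B4 -natrM cE => bound.
have L0 : (0 < L)%N.
  have mu0 := lt_le_trans (exprn_gt0 2 (sqrt_density_gt0 y10)) mu_ge.
  by move: mu0; rewrite pmulr_rgt0 ?exprn_gt0 // ltr0n.
have [M MM Me] := M_ex L0.
have En : (4 ^ s.+1 * (n %/ 4 ^ c).+1 - k = n)%N.
  by rewrite -cE /k subKn // ltnW; case/andP: n_div.
rewrite En in M MM Me.
have kB : k%:R / (4 ^ s.+1 * L)%:R <= (4 ^ s.+1)%:R / (4 ^ s.+1 * L)%:R :> R.
  by rewrite ler_wpM2r ?invr_ge0 // ler_nat.
apply: le_trans bound; apply: (u_le_entries _ MM) => [|i j].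
  by rewrite addr_ge0 ?divr_ge0 ?invr_ge0 ?sqrtr_ge0.
by apply: le_trans (Me i j) _; rewrite lerD2l.
Unshelve. all: by end_near.
Qed.
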